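(* Let $f$ be a symmetric nontrivial tradeoff function, let $N_c$ be a (continuous) canonical noise distribution (CND) for $f$ with cdf $F_{N_c}$, and let $\Delta$ be a positive integer. Then $N=\mathrm{round}(\Delta N_c)$, which has cdf $F_N(t)=F_{N_c}\left((\lfloor t\rfloor+1/2)/\Delta\right)$, is a discrete CND for $f$ at sensitivity $\Delta$.
   Context: For probability distributions $P,Q$ on a common measurable space, the tradeoff function $T(P,Q):[0,1]\to[0,1]$ is $T(P,Q)(\alpha)=\inf\{1-\mathbb{E}_Q(\phi)\mid \mathbb{E}_P(\phi)\leq 1-\alpha\}$, the infimum over measurable tests $\phi$ with values in $[0,1]$. For random variables $X,Y$, $T(X,Y)$ denotes the tradeoff function of their laws. A function $f:[0,1]\to[0,1]$ is a tradeoff function if $f=T(P,Q)$ for some $P,Q$; equivalently, $f$ is convex, continuous, non-decreasing, and $f(x)\leq x$ for all $x\in[0,1]$. It is nontrivial if $f(\alpha)<\alpha$ for some $\alpha\in(0,1)$, and symmetric if $f=T(P,Q)$ implies $f=T(Q,P)$. Inequalities between functions are pointwise. Canonical noise distribution: let $f$ be a symmetric tradeoff function and $N$ a continuous real random variable (continuous cdf) with cdf $F$. Then $F$ (or $N$) is a canonical noise distribution (CND) for $f$ if (1) $T(N,N+m)\geq f$ for all $m\in[0,1]$; (2) $f(\alpha)=T(N,N+1)(\alpha)$ for all $\alpha\in(0,1)$; (3) $T(N,N+1)(\alpha)=F(F^{-1}(\alpha)-1)$ for all $\alpha\in(0,1)$, where $F^{-1}$ is the quantile function; (4) $F(x)=1-F(-x)$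 for all $x\in\mathbb{R}$. Discrete CND: let $\Delta$ be a positive integer, $f$ a symmetric tradeoff function, and $N$ a random variable with cdf $F$. Then $F$ (or $N$) is a discrete CND for $f$ at sensitivity $\Delta$ if (1) $T(N,N+t)\geq f$ for all $t\in\{-\Delta,\ldots,\Delta\}$; (2) $f(F(t+\Delta))=F(t)$ for all $t\in\mathbb{Z}$ such that $F(t+\Delta)<1$; (3) $N$ takes values in $\mathbb{Z}$ and is symmetric about zero (i.e. $N$ and $-N$ have the same distribution). $\mathrm{round}(t)=\lfloor t+1/2\rfloor$. *)

(* Defs.v *)
From HB Require Import structures.
From mathcomp Require Import all_boot all_order all_algebra.
From mathcomp Require Import all_classical all_reals all_analysis.
(* all_analysis shadows the ring instances of {mfun T >-> R}; importing this
   file last restores them. *)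
From mathcomp Require Import measurable_realfun.

Set Implicit Arguments.
Unset Strict Implicit.
Unset Printing Implicit Defensive.

Import Order.TTheory GRing.Theory Num.Theory.
Import numFieldNormedType.Exports.

Local Open Scope classical_set_scope.
Local Open Scope ring_scope.

(* T(P,Q); a function on [0,1] is encoded as a function R -> R of which only
   the values on [0,1] are ever used. *)
Definition tradeoff (R : realType) (d : measure_display) (T : measurableType d)
    (P Q : probability T R) (a : R) : R :=
  inf [set 1 - fine 'E_Q[phi] | phi in
    [set phi : {mfun T >-> R} |
      (forall x, 0 <= phi x <= 1) /\ ('E_P[phi] <= (1 - a)%:E)%E]].

Definition tradeoffRV (R : realType) (d d1 d2 : measure_display)
    (T : measurableType d) (O1 : measurableType d1) (O2 : measurableType d2)
    (P1 : probability O1 R) (P2 : probability O2 R)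
    (X : {RV P1 >-> T}) (Y : {RV P2 >-> T}) : R -> R :=
  tradeoff (distribution P1 X) (distribution P2 Y).

Definition is_tradeoff_of (R : realType) (f : R -> R) (d : measure_display)
    (T : measurableType d) (P Q : probability T R) : Prop :=
  forall a : R, 0 <= a <= 1 -> f a = tradeoff P Q a.

Definition is_tradeoff (R : realType) (f : R -> R) : Prop :=
  exists (d : measure_display) (T : measurableType d) (P Q : probability T R),
    is_tradeoff_of f P Q.

Definition symmetric_tradeoff (R : realType) (f : R -> R) : Prop :=
  is_tradeoff f /\
  forall (d : measure_display) (T : measurableType d) (P Q : probability T R),
    is_tradeoff_of f P Q -> is_tradeoff_of f Q P.

Definition nontrivial_tradeoff (R : realType) (f : R -> R) : Prop :=
  exists a : R, 0 < a < 1 /\ f a < a.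

Definition cdfR (R : realType) (d : measure_display) (O : measurableType d)
    (P : probability O R) (X : {RV P >-> R}) (x : R) : R :=
  fine (cdf X x).

Definition quantile (R : realType) (F : R -> R) (a : R) : R :=
  inf [set x : R | a <= F x].

Definition shiftRV (R : realType) (d : measure_display) (O : measurableType d)
    (P : probability O R) (X : {RV P >-> R}) (m : R) : {RV P >-> R} :=
  (X \+ cst m : {mfun O >-> R}).

Record is_CND (R : realType) (f : R -> R) (d : measure_display)
    (O : measurableType d) (P : probability O R) (N : {RV P >-> R}) : Prop := {
  CND_continuous : continuous (cdfR N);
  CND_ge : forall m : R, 0 <= m <= 1 ->
    forall a : R, 0 <= a <= 1 -> f a <= tradeoffRV N (shiftRV N m) a;
  CND_eq : forall a : R, 0 < a < 1 -> f a = tradeoffRV N (shiftRV N 1) a;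
  CND_quantile : forall a : R, 0 < a < 1 ->
    tradeoffRV N (shiftRV N 1) a = cdfR N (quantile (cdfR N) a - 1);
  CND_sym : forall x : R, cdfR N x = 1 - cdfR N (- x) }.

Record is_discrete_CND (R : realType) (f : R -> R) (Delta : nat)
    (d : measure_display) (O : measurableType d) (P : probability O R)
    (N : {RV P >-> R}) : Prop := {
  dCND_ge : forall t : int, - Delta%:Z <= t <= Delta%:Z ->
    forall a : R, 0 <= a <= 1 -> f a <= tradeoffRV N (shiftRV N t%:~R) a;
  dCND_eq : forall t : int, cdfR N (t + Delta%:Z)%:~R < 1 ->
    f (cdfR N (t + Delta%:Z)%:~R) = cdfR N t%:~R;
  dCND_int : forall w : O, N w \is a Num.int;
  dCND_sym : forall A : set R, measurable A ->
    distribution P N A = distribution P (\- N : {mfun O >-> R}) A }.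

Definition round (R : realType) (t : R) : R := (Num.floor (t + 1 / 2))%:~R.

Lemma measurable_round (R : realType) : measurable_fun [set: R] (@round R).
Proof.
apply: nondecreasing_measurable => // x y xy.
by rewrite /round ler_int Num.Theory.le_floor// lerD2r.
Qed.

HB.instance Definition _ (R : realType) :=
  isMeasurableFun.Build _ _ R R (@round R) (@measurable_round R).

Definition roundRV (R : realType) (Delta : nat) (d : measure_display)
    (O : measurableType d) (P : probability O R) (N : {RV P >-> R}) :
    {RV P >-> R} :=
  (@round R \o (cst Delta%:R \* N) : {mfun O >-> R}).

(* Main.v *)
(* Rounding is post-processing: round(Delta (Nc + t / Delta)) is
   round(Delta Nc) + t, so the data processing inequality transports
   f <= T(Nc, Nc + |t| / Delta) to N; composing with the negation handles
   t < 0.  The recurrence f (F_N (t + Delta)) = F_N t is f (F (x + 1)) = F x for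
   F the cdf of Nc, which is the quantile condition as soon as F^-1 can be
   replaced by any point with the same value of F, i.e. as soon as F (x - 1)
   depends only on F x when 0 < F x < 1. *)
From HB Require Import structures.
Require Import Defs.
From mathcomp Require Import all_boot all_order all_algebra.
From mathcomp Require Import all_classical all_reals all_analysis.
From mathcomp Require Import measurable_realfun.
From mathcomp Require Import ring lra.

Import Order.TTheory GRing.Theory Num.Theory.
Import numFieldNormedType.Exports.

Local Open Scope classical_set_scope.
Local Open Scope ring_scope.

(** * Bounds on tradeoff functions and data processing *)

Section tradeoff_theory.
Context {R : realType} {d : measure_display} {T : measurableType d}.
Implicit Types (P Q : probability T R) (phi : {mfun T >-> R}).

Lemma fine_expectation_test_le1 P phi : (forall x, 0 <= phi x <= 1) ->
  fine 'E_P[phi] <= 1.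
Proof.
move=> h; have p0 x : 0 <= phi x by case/andP: (h x).
have E0 : (0 <= 'E_P[phi])%E by exact: expectation_ge0.
have E1 : ('E_P[phi] <= 1)%E.
  rewrite -(expectation_cst P 1); apply: expectation_le => //.
  by apply: aeW => x /=; case/andP: (h x).
by rewrite -lee_fin fineK// ge0_fin_numE// (le_lt_trans E1)// ltry.
Qed.

Lemma tradeoff_has_lbound P Q a : has_lbound
  [set 1 - fine 'E_Q[phi] | phi in
    [set phi : {mfun T >-> R} |
      (forall x, 0 <= phi x <= 1) /\ ('E_P[phi] <= (1 - a)%:E)%E]].
Proof.
by exists 0 => _ [phi [h _] <-]; rewrite subr_ge0 fine_expectation_test_le1.
Qed.

(** The indicator of [A], the deterministic test rejecting on [A], competes in the infimum. *)
Lemma tradeoff_le_set P Q a (A : set T) : measurable A ->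
  (P A <= (1 - a)%:E)%E -> tradeoff P Q a <= 1 - fine (Q A).
Proof.
move=> mA PA; rewrite -(expectation_indic Q mA).
apply: ge_inf; first exact: tradeoff_has_lbound.
exists (mindic R mA) => //; split; last by rewrite expectation_indic.
by move=> x; rewrite mindicE ler0n lern1 leq_b1.
Qed.

Lemma tradeoff_at0 P Q : tradeoff P Q 0 = 0.
Proof.
apply/eqP; rewrite eq_le; apply/andP; split.
  have := @tradeoff_le_set P Q 0 setT measurableT.
  by rewrite !probability_setT subr0 subrr; exact.
apply: lb_le_inf.
  exists (1 - fine 'E_Q[(cst 0 : {mfun T >-> R})]), (cst 0) => //; split.
    by move=> x /=; rewrite lexx ler01.
  by rewrite expectation_cst lee_fin subr0.
by move=> _ [phi [h _] <-]; rewrite subr_ge0 fine_expectation_test_le1.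
Qed.

End tradeoff_theory.

Lemma expectation_pushforward {R : realType} {d d' : measure_display}
    {T : measurableType d} {T' : measurableType d'}
    (P : probability T R) (P' : probability T' R) (g : {mfun T >-> T'})
    (phi : {mfun T' >-> R}) : (forall x, 0 <= phi x) ->
  (forall A, measurable A -> P' A = P (g @^-1` A)) ->
  ('E_P'[phi] = 'E_P[(phi \o g)])%E.
Proof.
move=> phi0 PP'; rewrite unlock.
rewrite -(@ge0_integral_pushforward _ _ _ _ _ g _ P setT (EFin \o phi))//.
  apply: eq_measure_integral => A mA _; exact: PP'.
- by apply/measurable_EFinP.
- by move=> y _; rewrite lee_fin.
Qed.

(** A test [phi] for [P'], [Q'] pulls back to [phi \o g] with the same two expectations, so the
    infimum for [P], [Q] runs over at least as many values. *)
Lemma tradeoff_data_processing {R : realType} {d d' : measure_display}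
    {T : measurableType d} {T' : measurableType d'}
    (P Q : probability T R) (P' Q' : probability T' R) (g : T -> T')
    (a : R) : a <= 1 -> measurable_fun setT g ->
  (forall A, measurable A -> P' A = P (g @^-1` A)) ->
  (forall A, measurable A -> Q' A = Q (g @^-1` A)) ->
  tradeoff P Q a <= tradeoff P' Q' a.
Proof.
move=> a1 mg hP hQ.
have @G : {mfun T >-> T'} := HB.pack g (isMeasurableFun.Build _ _ _ _ _ mg).
apply: lb_le_inf.
  (* The zero test shows that the right-hand infimum is over a nonempty set; this is where [a <= 1]
     enters. *)
  exists (1 - fine 'E_Q'[(cst 0 : {mfun T' >-> R})]), (cst 0) => //; split.
    by move=> x /=; rewrite lexx ler01.
  by rewrite expectation_cst lee_fin subr_ge0.
move=> _ [phi [h e] <-]; apply: ge_inf; first exact: tradeoff_has_lbound.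
have phi0 x : 0 <= phi x by case/andP: (h x).
exists (phi \o G : {mfun T >-> R}); last first.
  by rewrite (expectation_pushforward Q Q' G).
by split; [move=> x; exact: h|rewrite -(expectation_pushforward P P' G)].
Qed.

(** * Laws and quantiles of real random variables through their cdfs *)

Section cdf_theory.
Context {R : realType} {d : measure_display} {O : measurableType d}.
Context {P : probability O R}.
Implicit Types X : {RV P >-> R}.

Lemma cdfRE X x : (cdfR X x)%:E = P [set w | X w <= x].
Proof.
rewrite /cdfR fineK; last by rewrite fin_num_measure.
by rewrite /cdf /distribution /pushforward; congr (P _); apply/seteqP;
  split=> w /=; rewrite in_itv.
Qed.

Lemma measurable_RV_le X x : measurable [set w | X w <= x].
Proof.
rewrite (_ : [set _ | _] = X @^-1` `]-oo, x]); last first.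
  by apply/seteqP; split=> w /=; rewrite in_itv.
by apply: measurable_funPTI.
Qed.

Lemma measurable_RV_lt X x : measurable [set w | X w < x].
Proof.
rewrite (_ : [set _ | _] = X @^-1` `]-oo, x[); last first.
  by apply/seteqP; split=> w /=; rewrite in_itv.
by apply: measurable_funPTI.
Qed.

Lemma cdfR_ge0 X x : 0 <= cdfR X x. Proof. exact: fine_ge0. Qed.

Lemma cdfR_le1 X x : cdfR X x <= 1.
Proof.
by rewrite -lee_fin cdfRE; apply: probability_le1; exact: measurable_RV_le.
Qed.

Lemma cdfR_le X x y : x <= y -> cdfR X x <= cdfR X y.
Proof. by move=> xy; rewrite fine_le ?fin_num_measure// cdf_nondecreasing. Qed.

Lemma cdfR_exists_lt X e : 0 < e -> exists x, cdfR X x < e.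
Proof.
move=> e0; have /fine_cvg := cvg_cdfNy0 X.
move=> /(@cvgr_lt _ _ _ _ _ _) /(_ e e0) [M [_ h]].
by exists (M - 1); apply: h; rewrite ltrBlDr ltrDl.
Qed.

Lemma cdfR_exists_gt X e : e < 1 -> exists x, e < cdfR X x.
Proof.
move=> e1; have /fine_cvg := cvg_cdfy1 X.
move=> /(@cvgr_gt _ _ _ _ _ _) /(_ e e1) [M [_ h]].
by exists (M + 1); apply: h; rewrite ltrDl.
Qed.

(** Continuity excludes atoms: if the event [X < x] had mass below [cdfR X x], left continuity would
    give some [y < x] whose cdf still exceeds that mass, yet [X <= y] is contained in [X < x]. *)
Lemma prob_lt_cdfR X x : continuous (cdfR X) ->
  P [set w | X w < x] = (cdfR X x)%:E.
Proof.
move=> cX; apply/eqP; rewrite eq_le; apply/andP; split.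
  rewrite cdfRE le_measure ?inE//.
  - exact: measurable_RV_lt.
  - exact: measurable_RV_le.
  - by move=> w /= /ltW.
have Pfin : P [set w | X w < x] \is a fin_num.
  by rewrite fin_num_measure//; exact: measurable_RV_lt.
rewrite -(fineK Pfin) lee_fin leNgt; apply/negP => h.
have /(@cvgr_gt _ _ _ _ _ _) /(_ _ h) := cvg_at_left_filter (cX x).
move=> near_gt; have : \forall y \near x^'-, False; last first.
  by move=> /filter_ex[].
near=> y.
have : fine (P [set w | X w < x]) < cdfR X y by near: y.
apply/negP; rewrite -leNgt -lee_fin (fineK Pfin) cdfRE le_measure ?inE//.
- exact: measurable_RV_le.
- exact: measurable_RV_lt.
- by move=> w /= /le_lt_trans; apply; near: y; exact: nbhs_left_lt.
Unshelve. all: by end_near. Qed.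

(** The rays []x, +oo[] generate the Borel sets, are stable under intersection and exhaust the line,
    so uniqueness of measures applies. *)
Lemma eq_distribution_cdfR X (Y : {RV P >-> R}) :
  (forall x, cdfR X x = cdfR Y x) ->
  forall A, measurable A -> distribution P X A = distribution P Y A.
Proof.
move=> h; apply: (measure_unique (@RGenOInfty.G R)
    (fun n => `](- n%:R : R), +oo[%classic)).
- exact: RGenOInfty.measurableE.
- move=> _ _ [x ->] [y ->]; exists (Num.max x y); apply/seteqP.
  by split=> z /=; rewrite !in_itv/= !andbT gt_max => /andP.
- by move=> n; exists (- n%:R).
- apply/seteqP; split=> // x _; exists (Num.truncn `|x|).+1 => //=.
  rewrite in_itv/= andbT ltrNl; apply: le_lt_trans (truncnS_gt _).
  by rewrite -normrN ler_norm.
- move=> _ [x ->]; have -> : `]x, +oo[%classic = ~` `]-oo, x].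
    by rewrite setCitvl.
  rewrite [LHS](@probability_setC _ _ _ (distribution P X))//.
  rewrite [RHS](@probability_setC _ _ _ (distribution P Y))//; congr (1 - _)%E.
  rewrite -[LHS]fineK ?fin_num_measure// -[RHS]fineK ?fin_num_measure//.
  by congr EFin; exact: h.
- by move=> k; rewrite ltey_eq fin_num_measure.
Qed.

Lemma distribution_itv_oc X a b : a <= b ->
  distribution P X `]a, b] = (cdfR X b - cdfR X a)%:E.
Proof.
move=> ab; rewrite EFinB /cdfR !fineK ?fin_num_measure// /cdf.
have -> : `]a, b]%classic = `]-oo, b] `\` `]-oo, a].
  by rewrite -[RHS]setCK setCD setCitvl setUC -[LHS]setCK setCitv.
rewrite measureD ?setIidr//; first exact: subset_itvl.
by rewrite -ge0_fin_numE// fin_num_measure.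
Qed.

Lemma distribution_itv_oy X a :
  distribution P X `]a, +oo[ = (1 - cdfR X a)%:E.
Proof.
by rewrite -[LHS]/(ccdf X a) ccdf_1_cdf EFinB /cdfR fineK ?fin_num_measure.
Qed.

Lemma distribution_itv_oc_oy X a b c : a <= b -> b <= c ->
  distribution P X (`]a, b] `|` `]c, +oo[) =
  (cdfR X b - cdfR X a + (1 - cdfR X c))%:E.
Proof.
move=> ab bc; rewrite measureU//.
  by rewrite EFinD -distribution_itv_oc// -distribution_itv_oy.
apply/seteqP; split=> // y /=; rewrite !in_itv/= andbT => -[/andP[_ yb] cy].
by have := le_lt_trans (le_trans yb bc) cy; rewrite ltxx.
Qed.

Lemma cdfR_shift X m y : cdfR (shiftRV X m) y = cdfR X (y - m).
Proof.
apply: EFin_inj; rewrite !cdfRE; congr (P _).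
by apply/seteqP; split=> w /=; rewrite lerBrDr.
Qed.

(** Positivity of [cdfR X x] bounds the set below, since the cdf tends to 0 at minus infinity; right
    continuity then makes the infimum attained. *)
Lemma quantile_cdfR X x : continuous (cdfR X) -> 0 < cdfR X x ->
  quantile (cdfR X) (cdfR X x) <= x /\
  cdfR X (quantile (cdfR X) (cdfR X x)) = cdfR X x.
Proof.
move=> cX Fx0; set E := [set y | cdfR X x <= cdfR X y].
have lbE : has_lbound E.
  have [z Fz] := cdfR_exists_lt X _ Fx0; exists z => y /= Fy.
  by rewrite leNgt; apply/negP => /ltW/cdfR_le/(le_trans Fy); rewrite leNgt Fz.
have Ex : E x by rewrite /E/=.
have qx : inf E <= x by exact: ge_inf.
split=> //; apply/eqP; rewrite eq_le cdfR_le//= leNgt; apply/negP => Fq.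
have /(@cvgr_lt _ _ _ _ _ _) /(_ _ Fq) := cvg_at_right_filter (cX (inf E)).
move=> near_lt; have : \forall y \near (inf E)^'+, False; last first.
  by move=> /filter_ex[].
near=> y.
have qy : inf E < y by near: y; exact: nbhs_right_gt.
have [e Ee ey] : exists2 e, E e & e < inf E + (y - inf E).
  by apply: inf_adherent; [rewrite subr_gt0|split => //; exists x].
have : cdfR X y < cdfR X x by near: y.
apply/negP; rewrite -leNgt (le_trans Ee)// cdfR_le// ltW//.
by move: ey; rewrite addrC subrK.
Unshelve. all: by end_near. Qed.

(* With F the cdf of X and q the quantile of F x: if F (q - 1) < F (x - 1),
   then enlarging a threshold test beyond x by the X-null interval ]q, x]
   strictly increases its power, contradicting the optimality of threshold
   tests. *)
Lemma CND_cdfR (f : R -> R) X x : is_CND f X ->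
  0 < cdfR X x < 1 -> f (cdfR X x) = cdfR X (x - 1).
Proof.
move=> [cX _ feq fq _] /andP[F0 F1].
rewrite feq ?F0// fq ?F0//.
have [qx Fq] := quantile_cdfR _ _ cX F0; set q := quantile _ _ in qx Fq *.
apply/eqP; rewrite eq_le cdfR_le ?lerB//= leNgt; apply/negP => gap.
(* At [a = cdfR X x] the threshold test already rejects on []q, x]]. A larger [a] moves the
   threshold [q'] to the right of that interval, and [a < 1] keeps the quantile condition
   available. *)
have [y Fxy Fy1] : exists2 y, cdfR X x < cdfR X y & cdfR X y < 1.
  have [b Fb] := cdfR_exists_gt X _ F1.
  pose m := (cdfR X x + cdfR X b) / 2.
  have [Fxm mFb] : cdfR X x < m /\ m < cdfR X b.
    by move: Fb; rewrite /m; lra.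
  have xb : x <= b.
    by rewrite leNgt; apply/negP => /ltW/(cdfR_le X); rewrite leNgt Fb.
  have [c _ Fc] : exists2 c, c \in `[x, b] & cdfR X c = m.
    apply: IVT => //; first exact: continuous_subspaceT.
    by rewrite ge_min le_max (ltW Fxm) (ltW mFb) orbT.
  by exists c; rewrite Fc// (lt_le_trans mFb)// cdfR_le1.
have y0 : 0 < cdfR X y := lt_trans F0 Fxy.
have [_ Fqy] := quantile_cdfR _ _ cX y0.
have := fq (cdfR X y); rewrite y0 Fy1 => /(_ isT).
set q' := quantile _ _ in Fqy *.
have xq' : x <= q'.
  rewrite leNgt; apply/negP => /ltW/(cdfR_le X).
  by rewrite Fqy leNgt Fxy.
apply/eqP; rewrite lt_eqF//.
apply: le_lt_trans.
  (* Since []q, x]] is null for [X], this set has mass [1 - cdfR X y] and is admissible. Under the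
     shifted law the interval adds [cdfR X (x - 1) - cdfR X (q - 1)], positive by [gap]. *)
  apply: (@tradeoff_le_set _ _ _ _ _ _ (`]q, x] `|` `]q', +oo[)).
    exact: measurableU.
  by rewrite [leLHS](distribution_itv_oc_oy X _ _ _ qx xq') lee_fin
    Fq Fqy subrr add0r.
rewrite [fine _](congr1 fine
  (distribution_itv_oc_oy (shiftRV X 1) _ _ _ qx xq'))/=.
by rewrite !cdfR_shift; lra.
Qed.

End cdf_theory.

(** * The law of a rounded variable *)

Section rounding.
Context {R : realType} {d : measure_display} {O : measurableType d}.
Context {P : probability O R}.
Implicit Types N : {RV P >-> R}.

Lemma floor_shift_half (y : R) (n : int) :
  (Num.floor (y + 1 / 2) <= n) = (y < n%:~R + 1 / 2).
Proof. by rewrite -ltzD1 floor_lt_int intrD; apply/idP/idP; lra. Qed.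

(** Rounded values are integers, so only the floor of [t] matters; strictness comes from ties
    rounding up. *)
Lemma round_le (y t : R) : (round y <= t) = (y < (Num.floor t)%:~R + 1 / 2).
Proof. by rewrite /round -floor_ge_int floor_shift_half. Qed.

Lemma cdfR_round N (Delta : nat) t : continuous (cdfR N) -> (0 < Delta)%N ->
  cdfR (roundRV Delta N) t = cdfR N (((Num.floor t)%:~R + 1 / 2) / Delta%:R).
Proof.
move=> cN D0; apply: EFin_inj; rewrite cdfRE -prob_lt_cdfR//; congr (P _).
apply/seteqP; split=> w /=; rewrite round_le ltr_pdivlMr ?ltr0n// mulrC//.
Qed.

Lemma le_round (y t : R) :
  (- t <= round y) = (- ((Num.floor t)%:~R + 1 / 2) <= y).
Proof.
rewrite /round lerNl -intrN -floor_ge_int lerNl floor_ge_int.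
by rewrite intrN; apply/idP/idP; lra.
Qed.

(** [round] is not odd at ties, so the symmetry of the rounded law is obtained through cdfs: the
    event for the negated variable is the complement of a strict one, whose mass is a cdf value by
    continuity. *)
Lemma cdfR_opp_round N (Delta : nat) t : continuous (cdfR N) -> (0 < Delta)%N ->
  cdfR (\- roundRV Delta N : {RV P >-> R}) t =
  1 - cdfR N (- (((Num.floor t)%:~R + 1 / 2) / Delta%:R)).
Proof.
move=> cN D0; apply: EFin_inj; rewrite cdfRE EFinB -prob_lt_cdfR//.
rewrite -probability_setC; last exact: measurable_RV_lt.
have opp_round_le w : (- round (Delta%:R * N w) <= t) =
    ~~ (N w < - (((Num.floor t)%:~R + 1 / 2) / Delta%:R)).
  rewrite lerNl le_round -leNgt -mulNr ler_pdivrMr ?ltr0n//.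
  by rewrite (mulrC (N w)).
by congr (P _); apply/seteqP; split=> w /=; rewrite opp_round_le => /negP.
Qed.

End rounding.

Theorem proposition19 (R : realType) (f : R -> R)
    (hfs : symmetric_tradeoff f) (hfn : nontrivial_tradeoff f)
    (d : measure_display) (O : measurableType d) (P : probability O R)
    (Nc : {RV P >-> R}) (hNc : is_CND f Nc)
    (Delta : nat) (hDelta : (0 < Delta)%N) :
  (forall t : R, cdfR (roundRV Delta Nc) t =
     cdfR Nc (((Num.floor t)%:~R + 1 / 2) / Delta%:R)) /\
  is_discrete_CND f Delta (roundRV Delta Nc).
Proof.
have [cN f_ge _ _ Nsym] := hNc.
set N := roundRV Delta Nc.
have cdfN t : cdfR N t = cdfR Nc (((Num.floor t)%:~R + 1 / 2) / Delta%:R).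
  exact: cdfR_round.
have D0 : 0 < Delta%:R :> R by rewrite ltr0n.
have symN A : measurable A ->
    distribution P N A = distribution P (\- N : {RV P >-> R}) A.
  apply: eq_distribution_cdfR => t.
  by rewrite cdfR_opp_round// cdfN; exact: Nsym.
split=> //; split=> //.
- move=> t /andP[tlo thi] a /andP[a0 a1].
  (* The shift in the scale of [Nc]; it lies in [0,1] because [t] is at most [Delta] in absolute
     value. *)
  pose m : R := `|t|%:~R / Delta%:R.
  have m01 : 0 <= m <= 1.
    rewrite /m divr_ge0 ?ler0z ?ler0n//= ler_pdivrMr// mul1r.
    by rewrite [leRHS]pmulrn ler_int ler_norml tlo.
  apply: (le_trans (f_ge m m01 a _)); first by rewrite a0.
  have roundD (y : R) : round (Delta%:R * (y + m)) =
      round (Delta%:R * y) + `|t|%:~R.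
    rewrite /round /m mulrDr [_ * (_ / _)]mulrC divfK ?gt_eqF// addrAC.
    by rewrite floorDrz ?rpred_int// intrD intrKfloor.
  have mround : measurable_fun setT (fun y : R => round (Delta%:R * y)).
    by apply: measurableT_comp => //; exact: measurable_funM.
  rewrite /tradeoffRV; case: (leP 0 t) => [t0|t0].
    apply: (@tradeoff_data_processing R _ _ R R _ _ _ _
      (fun y => round (Delta%:R * y))) => // A mA.
    rewrite /distribution /pushforward; congr (P _); apply/seteqP.
    by split=> w /=; rewrite roundD ger0_norm.
  (* For [t < 0] the negated map sends [Nc] to [\- N], which has the law of [N] by [symN], and
     [Nc + m] to [\- N] shifted by [t], which has the law of [N] shifted by [t]. *)
  apply: (@tradeoff_data_processing R _ _ R R _ _ _ _
    (fun y => - round (Delta%:R * y))) => //.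
  - exact: measurableT_comp.
  - move=> A mA; have mAt : measurable ((fun x : R => x + t%:~R) @^-1` A).
      rewrite -[X in measurable X]setTI; apply: measurable_funD => //.
    rewrite [LHS](symN _ mAt) /distribution /pushforward.
    congr (P _); apply/seteqP.
    by split=> w /=; rewrite roundD ltr0_norm// opprD intrN opprK.
- move=> t; rewrite !cdfN !intrKfloor.
  have -> : ((t + Delta%:Z)%:~R + 1 / 2) / Delta%:R =
      (t%:~R + 1 / 2) / Delta%:R + 1 :> R.
    rewrite intrD -pmulrn; by field; rewrite gt_eqF.
  set x := (_ + 1 / 2) / _ => Fx1.
  have := cdfR_ge0 Nc (x + 1); rewrite le_eqVlt => /predU1P[F0|F0].
    have [[d' [T [P' [Q' fPQ]]]] _] := hfs.
    rewrite [X in f X](esym F0) fPQ ?lexx ?ler01// tradeoff_at0; apply/eqP.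
    by rewrite eq_sym eq_le cdfR_ge0 [leRHS]F0 cdfR_le ?lerDl.
  by rewrite (CND_cdfR f)// ?F0// addrK.
- by move=> w; rewrite /N/=/round; exact: intr_int.
Qed.
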